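(* For all integers $n,m,k\geq 0$: \begin{align*} Q_{n+k,k}&= \sum_{j=0}^{n}(-1)^{n-j}\binom{n}{j}I_{k+j},\\ Q_{n+k,k}&= \sum_{j=0}^{k}\binom{k}{j}M_{n+j},\\ Q_{n+m+k,m+k}&= \sum_{j=0}^{m}\binom{m}{j}Q_{n+k+j,k},\\ Q_{n+k,k}&= \sum_{j=0}^{\min\{n,k\}}\binom{k}{j}\binom{n}{j}j!\,I_{k-j}M_{n-j},\\ Q_{n+k,k}&= \sum_{j=\lfloor\frac{n+1}{2}\rfloor}^{\lfloor\frac{n+k+1}{2}\rfloor}\frac{k!}{(n+k-2j)!}\,I_{n+k-2j}\,B(n, j), \end{align*} where $B(n,j)=\frac{n!}{2^{n-j}(n-j)!(2j-n)!}$, and in the last sum any term containing the reciprocal of the factorial of a negative integer is taken to be $0$.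
   Context: An involution of a finite set is a permutation $\sigma$ with $\sigma^2=\mathrm{id}$. For $0\le k\le n$, $Q_{n,k}$ is the number of involutions of $[n+1]=\{1,\dots,n+1\}$ whose largest fixed point is $k+1$. $I_n$ is the number of involutions of $[n]$ ($I_0=1$), and $M_n$ is the number of fixed-point-free involutions of $[n]$ (so $M_{2r}=(2r-1)!!$, $M_0=1$, and $M_n=0$ for $n$ odd). $B(n,j)$ (Bessel number) counts partitions of $[n]$ into $j$ blocks each of size at most $2$. *)

(* Defs.v *)
From mathcomp Require Import all_boot all_order all_algebra all_fingroup.

Set Implicit Arguments.
Unset Strict Implicit.
Unset Printing Implicit Defensive.

Import Order.TTheory GRing.Theory Num.Theory.

(* The set [n] = {1, ..., n} is represented by 'I_n = {0, ..., n-1}, so the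
   ordinal of value k stands for the element k+1. *)

Definition involution (n : nat) (s : 'S_n) : bool := (s ^+ 2 == 1)%g.

Definition fixed_point (n : nat) (s : 'S_n) (i : 'I_n) : bool := s i == i.

Definition largest_fixed_point (n : nat) (s : 'S_n) (i : 'I_n) : bool :=
  fixed_point s i && [forall j, fixed_point s j ==> (j <= i)].

(* Only meaningful for k <= n; the value is 0 when n < k. *)
Definition Q (n k : nat) : nat :=
  #|[set s : 'S_n.+1 | involution s &
      [exists i : 'I_n.+1, (i == k :> nat) && largest_fixed_point s i]]|.

Definition Inv (n : nat) : nat := #|[set s : 'S_n | involution s]|.

Definition M (n : nat) : nat :=
  #|[set s : 'S_n | involution s & [forall i, ~~ fixed_point s i]]|.

(* [partition] already requires the blocks to be nonempty. *)
Definition B (n j : nat) : nat :=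
  #|[set P : {set {set 'I_n}} |
      [&& partition P [set: 'I_n], #|P| == j & [forall A in P, #|A| <= 2]]]|.

(* 1 / z!, with the convention that it is 0 for z < 0. *)
Definition inv_fact (z : int) : rat :=
  if z is Posz p then ((p`!)%:R^-1)%R else 0%R.

(* Main.v *)
Require Import Defs.
From mathcomp Require Import all_boot all_order all_algebra all_fingroup.
From mathcomp Require Import zify ring.

(* For disjoint sets E and F with k and n elements, let q(n, k) be the number of
   involutions of E U F without fixed point in F.  Looking at the image of an
   element of F gives q(n+1, k) = n q(n-1, k) + k q(n, k-1), and looking at the
   image of an element of E when F is empty gives q(0, k+1) = q(0, k) + k q(0, k-1).
   These determine q, with q(0, k) = I_k, q(n, 0) = M_n and q(n, k) = Q_{n+k,k};
   they imply q(n, k+1) = q(n, k) + q(n+1, k), of which the first three identities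
   are binomial iterations.  In the same way the block of one element gives
   B(n+1, j+1) = B(n, j) + n B(n-1, j).  The other identities hold because both
   sides obey the same recurrence. *)

Import Order.TTheory GRing.Theory Num.Theory.

Set Implicit Arguments.
Unset Strict Implicit.

(** * The recurrences and their basic consequence *)

(* Wherever the truncated predecessor below is applied to 0, its value is
   multiplied by 0. *)
Fixpoint telephone (k : nat) : nat :=
  if k is k'.+1 then telephone k' + k' * telephone k'.-1 else 1.

Fixpoint involn (n k : nat) : nat :=
  if n is n'.+1 then n' * involn n'.-1 k + k * involn n' k.-1 else telephone k.

Fixpoint bessel (n j : nat) : nat :=
  match n, j with
  | 0, 0 => 1
  | n'.+1, j'.+1 => bessel n' j' + n' * bessel n'.-1 j'
  | _, _ => 0
  end.

Lemma involnS (n k : nat) :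
  involn n.+1 k = n * involn n.-1 k + k * involn n k.-1.
Proof. by []. Qed.

Lemma besselS (n j : nat) :
  bessel n.+1 j.+1 = bessel n j + n * bessel n.-1 j.
Proof. by []. Qed.

Lemma involn0S (k : nat) :
  involn 0 k.+1 = involn 0 k + k * involn 0 k.-1.
Proof. by []. Qed.

Lemma involnSr (n k : nat) : involn n k.+1 = involn n k + involn n.+1 k.
Proof.
elim/ltn_ind: n k => -[_ k|n IHn]; first by rewrite involnS involn0S.
elim=> [|k IHk]; rewrite !involnS /=.
  case: n IHn => [|n] IHn //=; have := IHn n _ 0; rewrite !involnS /=; lia.
have := IHn n (ltnSn n) k; case: n IHn IHk => [|n] IHn IHk /=; rewrite ?involnS /=.
  lia.
have := IHn n _ k.+1; rewrite ?involnS /=; nia.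
Qed.

(** * Counting involutions without fixed points in a given set *)

Section Involutions.

Variable T : finType.
Implicit Types (E F : {set T}) (s : {perm T}).

(** The involutions live on the ambient type and are constrained by their support, so deleting
    points from E or F needs no relabelling. *)
Definition invols E F : {set {perm T}} :=
  [set s | [&& perm_on (E :|: F) s, (s ^+ 2 == 1)%g & [forall x in F, s x != x]]].

(** The hypothesis says that conjugation by [s] fixes the transposition, so the two commute and the
    square of the product is the product of squares. *)
Lemma tperm_perm_sqr (x y : T) s : tperm (s x) (s y) = tperm x y ->
  ((tperm x y * s) ^+ 2 = s ^+ 2)%g.
Proof.
move=> Hs; have C : commute (tperm x y) s.
  by apply/commgP/conjg_fixP; rewrite tpermJ.
by rewrite expgMn // expgS expg1 tperm2 mul1g.
Qed.

(* Left multiplication by [tperm x y] splits the cycle (x y) off an involution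
   mapping x to y (and does nothing when x = y). *)
Lemma card_invols_image E F (x y : T) :
  x \in E :|: F -> y \in E :|: F -> (y == x) ==> (x \notin F) ->
  #|[set s in invols E F | s x == y]|
    = #|invols (E :\: [set x; y]) (F :\: [set x; y])|.
Proof.
move=> xEF yEF /implyP Hyx.
rewrite -(card_imset (mem (invols (E :\: [set x; y]) (F :\: [set x; y]))) (mulgI (tperm x y))).
apply: eq_card => s; rewrite !inE; apply/idP/imsetP.
  case/andP=> /and3P[sEF s2 /forall_inP sF] /eqP sx.
  have ss z : s (s z) = z.
    by move/eqP/permP/(_ z): s2; rewrite expgS expg1 permM perm1.
  have sy : s y = x by rewrite -sx ss.
  exists (tperm x y * s)%g; last by rewrite mulgA tperm2 mul1g.
  rewrite !inE tperm_perm_sqr ?s2 1?tpermC ?sx ?sy //; apply/and3P; split=> //.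
    apply/subsetP => z; rewrite !inE permM.
    case: tpermP => [->|->|/eqP zx /eqP zy]; rewrite ?sx ?sy ?eqxx // => sz.
    by move/subsetP/(_ z sz): sEF; rewrite (negPf zx) (negPf zy) inE.
  apply/forall_inP => z; rewrite !inE negb_or -andbA => /and3P[zx zy zF].
  by rewrite permM tpermD ?sF // eq_sym.
case=> s' ; rewrite !inE => /and3P[s'D s'2 /forall_inP s'F] ->.
have s'x : s' x = x by apply: (out_perm s'D); rewrite !inE eqxx.
have s'y : s' y = y by apply: (out_perm s'D); rewrite !inE eqxx orbT.
rewrite tperm_perm_sqr ?s'x ?s'y // s'2 permM tpermL s'y eqxx andbT /=.
apply/andP; split.
  apply/subsetP => z; rewrite inE permM.
  case: tpermP => [-> //|-> //|_ _ sz].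
  by move/subsetP/(_ z sz): s'D; rewrite !inE; do !case: (_ \in _); rewrite ?andbF.
apply/forall_inP => z zF; rewrite permM.
case: tpermP => [zx|zy|/eqP zx /eqP zy].
(* If [z] is [x] or [y], its image is the other of the two; they differ, since [y = x] is allowed
   only outside F. *)
- by rewrite s'y zx; apply/negP => /Hyx; rewrite -zx zF.
- by rewrite s'x zy; apply/negP => /eqP xy; move: Hyx; rewrite -xy eqxx xy -zy zF => /(_ isT).
- by apply: s'F; rewrite !inE negb_or zx zy.
Qed.

(** Classify by the image [y] of [x]; the condition on [y] rules out [y = x] exactly when [x] must
    be moved. *)
Lemma card_invols_split E F (x : T) : x \in E :|: F ->
  #|invols E F| = \sum_(y in E :|: F | (y == x) ==> (x \notin F))
     #|invols (E :\: [set x; y]) (F :\: [set x; y])|.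
Proof.
move=> xEF.
rewrite -sum1_card
  (partition_big (fun s => s x) (fun y => (y \in E :|: F) && ((y == x) ==> (x \notin F)))) /=.
  apply: eq_bigr => y /andP[yEF Hy]; rewrite -card_invols_image // -sum1_card.
  by apply: eq_bigl => s; rewrite [in RHS]inE.
move=> s; rewrite inE => /and3P[sEF _ /forall_inP sF].
rewrite (perm_closed _ sEF) xEF /=; apply/implyP => sx.
by apply/negP => /sF; rewrite sx.
Qed.

End Involutions.

Lemma setD1_notin (T : finType) (A : {set T}) (x : T) : x \notin A -> A :\ x = A.
Proof. by move=> xA; apply/setDidPl; rewrite disjoint_sym disjoints1. Qed.

(** Induction on the size of the union, since a pair may take points from both sets. The split point
    is taken in F as long as F is nonempty, matching the order in which [involn] recurses. *)
Lemma card_invols (T : finType) (E F : {set T}) : [disjoint E & F] ->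
  #|invols E F| = involn #|F| #|E|.
Proof.
have [N] := ubnP #|E :|: F|; elim: N E F => // N IHN E F ltEF disEF.
have step x y : x \in E :|: F -> y \in E :|: F ->
    #|invols (E :\: [set x; y]) (F :\: [set x; y])|
      = involn #|F :\: [set x; y]| #|E :\: [set x; y]|.
  move=> xEF yEF; apply: IHN.
    rewrite -setDUl; apply: leq_trans (_ : #|(E :|: F) :\ x| < N).
      by rewrite ltnS subset_leq_card // setDS // sub1set !inE eqxx.
    by move: ltEF; rewrite (cardsD1 x) xEF.
  by apply: disjointWl (subsetDl _ _) (disjointWr (subsetDl _ _) disEF).
have nEF z : z \in E -> z \notin F by move=> zE; rewrite (disjointFr disEF).
have [F0|[x xF]] := set_0Vmem F.
  subst F; have [E0|[x xE]] := set_0Vmem E.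
    subst E; rewrite !cards0 /= (_ : invols _ _ = [set 1%g]) ?cards1 //.
    apply/setP => s; rewrite !inE setU0; apply/idP/eqP => [/and3P[s0 _ _]|->].
      by apply/permP => z; rewrite perm1 (out_perm s0) ?inE.
    by rewrite perm_on1 expg1n eqxx /=; apply/forall_inP => z; rewrite inE.
  have xEF : x \in E :|: set0 by rewrite inE xE.
  (* With F empty, [y = x] gives the first term of [involn0S] and the other points of E give the
     second. *)
  rewrite (card_invols_split xEF) (bigD1 x) ?inE ?xE ?implybT //= step //.
  rewrite set0D cards0 setUid (cardsD1 x E) xE add1n involn0S; congr (_ + _).
  rewrite -sum_nat_const [RHS](eq_bigl (fun y => (y \in E :|: set0) && (y != x))); last first.
    by move=> y; rewrite !inE orbF andbC.
  apply: eq_big => [y|y /andP[/andP[yE _] yx]]; first by rewrite !inE implybT andbT.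
  rewrite step // set0D cards0; congr involn.
  move: yE; rewrite !inE orbF => yE.
  by rewrite -setDDl [in RHS](cardsD1 y (E :\ x)) !inE yx yE.
have xEF : x \in E :|: F by rewrite inE xF orbT.
have xE : x \notin E by apply/negP => /nEF; rewrite xF.
(* Images in E give the second term of [involnS], images in F other than [x] the first. *)
rewrite (card_invols_split xEF) (cardsD1 x F) xF add1n involnS addnC /=.
rewrite (bigID (fun y => y \in E)) /=; congr (_ + _).
  rewrite -sum_nat_const; apply: eq_big => [y|y /andP[/andP[yEF _] yE]].
    rewrite !inE implybF; case yE: (y \in E) => /=; rewrite ?andbF // andbT.
    by apply/eqP => yx; rewrite -yx yE in xE.
  rewrite step // -!setDDl; congr involn.
    by rewrite (@setD1_notin _ (F :\ x)) // in_setD1 negb_and nEF ?orbT.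
  by rewrite (setD1_notin xE) [in RHS](cardsD1 y E) yE.
rewrite -sum_nat_const; apply: eq_big => [y|y /andP[/andP[yEF yx] yE]].
  rewrite !inE implybF; case yE: (y \in E) => /=; rewrite ?andbF ?andbT.
    by rewrite (negPf (nEF _ yE)) andbF.
  by rewrite andbC.
move: yx yEF; rewrite implybF !inE (negPf yE) /= => yx yF.
rewrite step ?inE ?yF ?xF ?orbT //; congr involn.
  by rewrite -setDDl [in RHS](cardsD1 y (F :\ x)) !inE yx yF.
by rewrite -setDDl (setD1_notin xE) (setD1_notin yE).
Qed.

(** * The counts I, M and Q as values of [involn] *)

Lemma Inv_involn (n : nat) : Inv n = involn 0 n.
Proof.
have disT0 : [disjoint [set: 'I_n] & set0] by rewrite -setI_eq0 setI0.
have := card_invols disT0; rewrite cards0 cardsT card_ord => <-.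
apply: eq_card => s; rewrite !inE /involution; case: (_ == _); rewrite ?andbF //=.
rewrite setU0 andbC; apply/esym/andP; split; last by apply/subsetP => i; rewrite inE.
by apply/forall_inP => i; rewrite inE.
Qed.

Lemma M_involn (n : nat) : M n = involn n 0.
Proof.
have dis0T : [disjoint set0 & [set: 'I_n]] by rewrite -setI_eq0 set0I.
have := card_invols dis0T; rewrite cards0 cardsT card_ord => <-.
apply: eq_card => s; rewrite !inE /involution; case: (_ == _); rewrite ?andbF //=.
rewrite set0U; have -> : perm_on [set: 'I_n] s by apply/subsetP => i; rewrite inE.
by apply/forallP/forall_inP => sF i; [move=> _; exact: (sF i)|exact: (sF i (in_setT i))].
Qed.

(** The point of value [k] is fixed, so it leaves the support; the [k] smaller points (E) are
    unconstrained and the [n] larger ones (F) must all be moved. *)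
Lemma Q_involn (n k : nat) : Q (n + k) k = involn n k.
Proof.
pose E := [set i : 'I_(n + k).+1 | i < k]; pose F := [set i : 'I_(n + k).+1 | k < i].
have kn : k < (n + k).+1 by rewrite ltnS leq_addl.
pose o := Ordinal kn.
have cE : #|E| = k.
  rewrite (_ : E = [set widen_ord (ltnW kn) i | i : 'I_k]).
    by rewrite card_imset ?card_ord // => i j /(congr1 val) /= /val_inj.
  apply/setP => i; rewrite inE; apply/idP/imsetP => [ik|[j _ ->]]; last exact: (ltn_ord j).
  by exists (Ordinal ik); last apply/val_inj.
have EF : E :|: F = ~: [set o] by apply/setP => i; rewrite !inE -val_eqE /= neq_ltn.
have dEF : [disjoint E & F].
  by rewrite -setI_eq0; apply/eqP/setP => i; rewrite !inE; case: ltngtP.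
have cF : #|F| = n.
  have := cardsC1 o; rewrite -EF cardsU disjoint_setI0 // cards0 subn0 cE card_ord /=; lia.
have := card_invols dEF; rewrite cE cF => <-.
apply: eq_card => s; rewrite !inE /involution EF andbCA; congr (_ && _).
apply/existsP/andP.
  case=> i /andP[/eqP ik /andP[si /forallP sl]].
  have {}ik : i = o by apply/val_inj.
  subst i; split.
    by apply/subsetP => j; rewrite !inE; apply: contra => /eqP ->.
  apply/forall_inP => j; rewrite inE ltnNge; apply: contra => sj.
  exact: (implyP (sl j) sj).
case=> so /forall_inP sF; exists o; rewrite eqxx /=; apply/andP; split.
  by apply/eqP/(out_perm so); rewrite !inE eqxx.
apply/forallP => j; apply/implyP => sj; rewrite leqNgt; apply/negP => kj.
by move: sj; apply/negP/sF; rewrite inE.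
Qed.

(** * Partitions into blocks of size at most two *)

Section BesselPartitions.

Variable T : finType.
Implicit Types (D : {set T}) (P : {set {set T}}).

Definition bessel_partitions D j : {set {set {set T}}} :=
  [set P | [&& partition P D, #|P| == j & [forall A in P, #|A| <= 2]]].

(** Removing the block of [x] is inverse to adding it back; [y = x] covers the singleton block. *)
Lemma card_bessel_partitions_image D j (x y : T) : x \in D -> y \in D ->
  #|[set P in bessel_partitions D j.+1 | pblock P x == [set x; y]]|
    = #|bessel_partitions (D :\: [set x; y]) j|.
Proof.
move=> xD yD; set B := [set x; y].
have xB : x \in B by rewrite !inE eqxx.
have B0 : B != set0 by apply/set0Pn; exists x.
have BD : B \subset D by rewrite subUset !sub1set xD.
have nB P : partition P (D :\: B) -> B \notin P.
  move=> PD; apply/negP => /(partitionS PD)/subsetP/(_ x xB).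
  by rewrite !inE eqxx.
(* Adding [B] is injective only on families that do not contain [B], hence the restricted form of
   injectivity. *)
rewrite -(@card_in_imset _ _ (fun P => B |: P) (bessel_partitions (D :\: B) j)); last first.
  move=> P P' /=; rewrite !inE => /and3P[PD _ _] /and3P[PD' _ _] eqP.
  by rewrite -(setU1K (nB _ PD)) eqP setU1K ?nB.
apply: eq_card => P; rewrite !inE; apply/idP/imsetP.
  case/andP=> /and3P[PD cP /forall_inP sP] /eqP Px.
  have BP : B \in P by rewrite -Px pblock_mem // (cover_partition PD).
  exists (P :\ B); last by rewrite setD1K.
  rewrite inE partitionD1 //=; move: cP; rewrite (cardsD1 B) BP eqSS => -> /=.
  by apply/forall_inP => A; rewrite !inE => /andP[_]; apply: sP.
case=> P'; rewrite inE => /and3P[PD /eqP cP /forall_inP sP] ->.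
have PD' : partition (B |: P') D.
  have := partitionU1 PD B0; rewrite -setI_eq0 setIDA setIC setDIl setDv setI0 eqxx.
  move=> /(_ isT).
  by rewrite [B :|: _](_ : _ = D) // -{1}(setIidPr BD) setID.
rewrite PD' cardsU1 nB // cP eqxx /=; apply/andP; split.
  apply/forall_inP => A; rewrite !inE => /orP[/eqP ->|]; last exact: sP.
  by rewrite cards2; case: (_ != _).
by apply/eqP/def_pblock; rewrite ?(partition_trivIset PD') ?inE ?eqxx.
Qed.

Lemma card_bessel_partitions_split D j (x : T) : x \in D ->
  #|bessel_partitions D j.+1|
    = \sum_(y in D) #|bessel_partitions (D :\: [set x; y]) j|.
Proof.
move=> xD; rewrite -sum1_card.
rewrite (partition_big (fun P => pblock P x) (mem [set [set x; y] | y in D])) /=.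
  rewrite big_imset /=.
    apply: eq_bigr => y yD; rewrite -card_bessel_partitions_image // -sum1_card.
    by apply: eq_bigl => P; rewrite [in RHS]inE.
  move=> y z _ _ yz; have /set2P[yx|//] : y \in [set x; z] by rewrite -yz !inE eqxx orbT.
  have /set2P[zx|//] : z \in [set x; y] by rewrite yz !inE eqxx orbT.
  by rewrite yx zx.
move=> P; rewrite inE => /and3P[PD _ /forall_inP sP].
have xP : x \in cover P by rewrite (cover_partition PD).
have BP := pblock_mem xP; have := sP _ BP.
have xB : x \in pblock P x by rewrite mem_pblock.
(* Without [x] the block has at most one element: it is [y], or the block is the singleton of
   [x]. *)
rewrite (cardsD1 x) xB add1n ltnS leq_eqVlt ltnS leqn0 cards_eq0.
move=> /orP[/cards1P[y By]|/eqP B0].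
  apply/imsetP; exists y; last by rewrite -By setD1K.
  apply: (subsetP (partitionS PD BP)).
  by have /setD1P[] : y \in pblock P x :\ x by rewrite By set11.
by apply/imsetP; exists x; rewrite // -[LHS](setD1K xB) B0 setU0 setUid.
Qed.

(** Splitting off a block lowers [j] by exactly one whatever its size, so a plain induction on [j],
    for all [D], suffices. *)
Lemma card_bessel_partitions D j : #|bessel_partitions D j| = bessel #|D| j.
Proof.
elim: j D => [|j IHj] D; have [D0|[x xD]] := set_0Vmem D.
- subst D; rewrite cards0 /= -(cards1 (set0 : {set {set T}})); apply: eq_card => P.
  rewrite !inE partition_set0; apply/and3P/eqP => [[/eqP-> //]|->].
  by rewrite cards0 eqxx; split=> //; apply/forall_inP => A; rewrite inE.
- rewrite (cardsD1 x) xD /=; apply: eq_card0 => P; rewrite !inE.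
  apply/negP => /and3P[PD]; rewrite cards_eq0 => /eqP P0 _.
  by move: xD; rewrite -(cover_partition PD) P0 /cover big_set0 inE.
- subst D; rewrite cards0 /=; apply: eq_card0 => P; rewrite !inE partition_set0.
  by apply/negP => /and3P[/eqP ->]; rewrite cards0.
rewrite (card_bessel_partitions_split j xD) (bigD1 x) //= IHj setUid.
rewrite (cardsD1 x D) xD add1n besselS; congr (_ + _).
rewrite -sum_nat_const; apply: eq_big => [y|y /andP[yD yx]].
  by rewrite !inE andbC.
by rewrite IHj -setDDl [in RHS](cardsD1 y (D :\ x)) !inE yx yD.
Qed.

End BesselPartitions.

Lemma B_bessel (n j : nat) : B n j = bessel n j.
Proof. by rewrite -[n in RHS]card_ord -cardsT -card_bessel_partitions. Qed.

(** * Binomial sums *)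

(** Pascal's rule under a sum, over any commutative monoid so that it serves both natural and signed
    integer sums. *)
Lemma sum_binS (V : nmodType) (m : nat) (f : nat -> V) :
  (\sum_(0 <= j < m.+2) f j *+ 'C(m.+1, j)
    = \sum_(0 <= j < m.+1) f j *+ 'C(m, j)
      + \sum_(0 <= j < m.+1) f j.+1 *+ 'C(m, j))%R.
Proof.
rewrite big_nat_recl // [X in (_ = X + _)%R]big_nat_recl // !bin0 -addrA; congr (_ + _)%R.
rewrite (eq_bigr _ (fun j _ => congr1 (fun c => f j.+1 *+ c)%R (binS m j))).
rewrite (eq_bigr _ (fun j _ => mulrnDr _ _ _)) big_split /=; congr (_ + _)%R.
by rewrite big_nat_recr //= bin_small // mulr0n addr0.
Qed.

(** Among [m] marked points of E, the [j] moved ones join F and the others are fixed; this iterates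
    [involnSr]. The case [k = 0] expresses everything through M. *)
Lemma involn_sum_bin (n m k : nat) :
  involn n (m + k) = \sum_(0 <= j < m.+1) 'C(m, j) * involn (n + j) k.
Proof.
elim: m n k => [|m IHm] n k; first by rewrite big_nat1 addn0 mul1n.
transitivity (\sum_(0 <= j < m.+2) involn (n + j) k *+ 'C(m.+1, j))%R; last first.
  by apply: eq_bigr => j _; rewrite -mulr_natr natn mulnC.
rewrite sum_binS addSn involnSr !IHm; congr (_ + _).
  by apply: eq_bigr => j _; rewrite -mulr_natr natn mulnC.
by apply: eq_bigr => j _; rewrite -mulr_natr natn mulnC addSnnS.
Qed.

(** By [involnSr], raising [n] by one takes a forward difference in [k], so this is the [n]-th
    difference of the numbers I. *)
Lemma involn_alternating_sum (n k : nat) :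
  ((involn n k)%:Z
     = \sum_(0 <= j < n.+1)
         (-1) ^+ (n - j) * ('C(n, j))%:Z * (involn 0 (k + j))%:Z :> int)%R.
Proof.
elim: n k => [|n IHn] k; first by rewrite big_nat1 addn0 bin0 !mul1r.
have -> : ((involn n.+1 k)%:Z = (involn n k.+1)%:Z - (involn n k)%:Z)%R.
  by rewrite involnSr PoszD addrC addKr.
transitivity (\sum_(0 <= j < n.+2)
    ((-1) ^+ (n.+1 - j) * (involn 0 (k + j))%:Z) *+ 'C(n.+1, j))%R; last first.
  by apply: eq_bigr => j _; rewrite mulrAC -mulr_natr natz.
rewrite sum_binS [RHS]addrC !IHn; congr (_ + _)%R.
  by apply: eq_bigr => j _; rewrite subSS addSnnS mulrAC -mulr_natr natz.
rewrite -sumrN !big_nat; apply: eq_bigr => j /andP[_ jn].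
by rewrite subSn // exprS mulrAC -mulr_natr natz mulN1r !mulNr.
Qed.

(** Here [j] counts the points of F matched into E: choose them, their partners and a bijection; the
    rest of F is matched within itself and the rest of E is free. *)
Lemma involn_matching_sum (n k : nat) :
  involn n k = \sum_(0 <= j < n.+1)
          'C(k, j) * 'C(n, j) * j`! * involn 0 (k - j) * involn (n - j) 0.
Proof.
elim/ltn_ind: n k => -[_|n IHn] k.
  by rewrite big_nat1 !subn0 !bin0 !mul1n muln1.
rewrite involnS.
(* From [n * 'C(n.-1, j) = (n - j) * 'C(n, j)] and the recurrence of M. The top term is zero and
   only aligns the range. *)
have -> : n * involn n.-1 k = \sum_(0 <= j < n.+2)
    'C(k, j) * 'C(n, j) * j`! * involn 0 (k - j) * involn (n.+1 - j) 0.
  rewrite big_nat_recr //= [X in _ + X](_ : _ = 0) ?addn0; last first.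
    by rewrite (bin_small (ltnSn n)) muln0 !mul0n.
  case: n IHn => [|n] IHn; first by rewrite mul0n big_nat1 subn0 [involn 1 0]/= muln0.
  rewrite (IHn n) // [RHS]big_nat_recr //= subSn // subnn /= !muln0 addn0 big_distrr.
  rewrite !big_nat; apply: eq_bigr => j /andP[_ jn].
  rewrite (subSn (ltnW jn)) involnS mul0n addn0 (subSn (jn : j <= n)) /=.
  transitivity (n.+1 * 'C(n, j) * ('C(k, j) * j`! * telephone (k - j) * involn (n - j) 0)).
    by rewrite /=; lia.
  by rewrite (mul_bin_down n.+1 j) (subSn (jn : j <= n)); lia.
(* Absorption, [k * 'C(k.-1, j) = j.+1 * 'C(k, j.+1)]; Pascal's rule then joins the two sums. *)
have -> : k * involn n k.-1 = \sum_(0 <= j < n.+1)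
    'C(k, j.+1) * 'C(n, j) * j.+1`! * involn 0 (k - j.+1) * involn (n - j) 0.
  rewrite (IHn n) // big_distrr; apply: eq_bigr => j _ /=.
  case: k => [|k]; first by rewrite bin0n !mul0n.
  rewrite subSS factS /= !mulnA mul_bin_diag; congr (_ * _ * _); lia.
rewrite [RHS]big_nat_recl // [X in X + _]big_nat_recl // -addnA; congr (_ + _).
  by rewrite !bin0.
rewrite -big_split; apply: eq_bigr => j _ /=.
by rewrite binS subSS; lia.
Qed.

(** * Closed form of the Bessel numbers and the Bessel sum *)

Section ClosedForms.

Local Open Scope ring_scope.

(** The convention at negative integers makes this valid for every [z], including 0, which absorbs
    the boundary cases below. *)
Lemma inv_fact_mul (z : int) : z%:~R * inv_fact z = inv_fact (z - 1).
Proof.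
case: z => [[|p]|p]; first by rewrite mul0r.
  have -> : p.+1%:Z - 1 = p by lia.
  rewrite /inv_fact factS natrM invfM mulrA mulfV ?mul1r //.
  by rewrite pnatr_eq0.
by rewrite mulr0 [Negz p - 1](_ : _ = Negz p.+1) //; lia.
Qed.

Lemma inv_fact_neg (z : int) : z < 0 -> inv_fact z = 0.
Proof. by case: z. Qed.

(** After a common factor is taken out, the two terms of [besselS] contribute [2j + 1 - n] and
    [2(n - j)], which add up to [n + 1]. *)
Lemma bessel_closed (n j : nat) :
  (bessel n j)%:R
    = (n`!)%:R * (2 ^ (n%:Z - j%:Z))^-1
      * inv_fact (n%:Z - j%:Z) * inv_fact ((2 * j)%:Z - n%:Z) :> rat.
Proof.
have [N] := ubnP n; elim: N n j => // N IHN [|n] [|j] ltnN //=.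
- by rewrite mulr0 mul0r.
- by rewrite mulr0.
have -> : n.+1%:Z - j.+1%:Z = n%:Z - j%:Z by lia.
rewrite natrD natrM (IHN n j ltnN).
have two (z : int) : (2 : rat) ^ (z - 1) = 2 ^ z / 2 by rewrite expfzDr.
have -> : n%:R * (bessel n.-1 j)%:R
    = n`!%:R * (2 ^ (n%:Z - j%:Z))^-1 * 2 * ((n%:Z - j%:Z)%:~R * inv_fact (n%:Z - j%:Z)) 
      * inv_fact ((2 * j.+1)%:Z - n.+1%:Z) :> rat.
  rewrite inv_fact_mul; case: n ltnN => [|n] ltnN /=.
    by rewrite inv_fact_neg ?mulr0 ?mul0r //; lia.
  rewrite (IHN n j (ltnW ltnN)).
  have -> : n%:Z - j%:Z = n.+1%:Z - j%:Z - 1 by lia.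
  have -> : (2 * j.+1)%:Z - n.+2%:Z = (2 * j)%:Z - n%:Z by lia.
  by rewrite two invfM invrK factS natrM; ring.
have -> : inv_fact ((2 * j)%:Z - n%:Z)
    = ((2 * j.+1)%:Z - n.+1%:Z)%:~R * inv_fact ((2 * j.+1)%:Z - n.+1%:Z).
  by rewrite inv_fact_mul; congr inv_fact; lia.
have -> : (2 * j.+1)%:Z - n.+1%:Z = 2 * j%:Z + 1 - n%:Z by lia.
rewrite factS natrM !(rmorphB, rmorphD, rmorphM) /= -!pmulrn.
by rewrite -addn1 natrD; ring.
Qed.

Lemma bessel_small (n j : nat) : (2 * j < n)%N -> bessel n j = 0%N.
Proof.
move=> jn; apply/eqP; rewrite -(@pnatr_eq0 rat) bessel_closed.
by rewrite [X in _ * X]inv_fact_neg ?mulr0 //; lia.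
Qed.

(** Cut F into [j] blocks: pairs are 2-cycles, the [2j - n] singletons are sent injectively into E,
    and [n + k - 2j] points of E stay free. Both terms of [involnS] lower [n + k] by 2, so a free
    bound [N] lets both hypotheses be used at the same smaller bound. *)
Lemma involn_bessel_sum (n k N : nat) : (n + k < 2 * N)%N ->
  (involn n k)%:R
    = \sum_(0 <= j < N) (k`!)%:R * inv_fact ((n + k)%:Z - (2 * j)%:Z)
            * (involn 0 (n + k - 2 * j))%:R * (bessel n j)%:R :> rat.
Proof.
elim/ltn_ind: n k N => -[_|n IHn] k [|N] // ltN.
  rewrite big_nat_recl // big1 ?addr0; last by move=> j _; rewrite mulr0.
  by rewrite add0n muln0 subn0 mulr1 /= mulfV ?mul1r // pnatr_eq0 -lt0n fact_gt0.
rewrite big_nat_recl // [bessel n.+1 0]/= mulr0 add0r involnS natrD !natrM.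
have -> : n%:R * (involn n.-1 k)%:R =
    \sum_(0 <= j < N) (k`!)%:R * inv_fact ((n.+1 + k)%:Z - (2 * j.+1)%:Z)
            * (involn 0 (n.+1 + k - 2 * j.+1))%:R * (n * bessel n.-1 j)%:R :> rat.
  case: n IHn ltN => [|n] IHn ltN.
    by rewrite mul0r big1 // => j _; rewrite mul0n mulr0.
  rewrite (IHn n _ k N) //; last by lia.
  rewrite mulr_sumr; apply: eq_bigr => j _.
  have -> : (n.+2 + k)%:Z - (2 * j.+1)%:Z = (n + k)%:Z - (2 * j)%:Z by lia.
  have -> : (n.+2 + k - 2 * j.+1 = n + k - 2 * j)%N by lia.
  by rewrite natrM; ring.
have -> : k%:R * (involn n k.-1)%:R =
    \sum_(0 <= j < N) (k`!)%:R * inv_fact ((n.+1 + k)%:Z - (2 * j.+1)%:Z)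
            * (involn 0 (n.+1 + k - 2 * j.+1))%:R * (bessel n j)%:R :> rat.
  case: k ltN => [|k] ltN.
    (* With E empty each term vanishes: through the Bessel number if [2j < n], otherwise through the
       reciprocal factorial. *)
    rewrite mul0r big1 // => j _; have [jn|nj] := ltnP (2 * j) n.
      by rewrite bessel_small // mulr0.
    by rewrite inv_fact_neg ?mulr0 ?mul0r //; lia.
  rewrite (IHn n _ k N) //; last by lia.
  rewrite mulr_sumr; apply: eq_bigr => j _.
  have -> : (n.+1 + k.+1)%:Z - (2 * j.+1)%:Z = (n + k)%:Z - (2 * j)%:Z by lia.
  have -> : (n.+1 + k.+1 - 2 * j.+1 = n + k - 2 * j)%N by lia.
  by rewrite factS natrM; ring.
rewrite -big_split; apply: eq_bigr => j _ /=.
by rewrite natrD mulrDr addrC.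
Qed.

End ClosedForms.

(** * The identities for Q, with the summation ranges adjusted *)

Theorem theorem4p1 (n m k : nat) :
  ((Q (n + k) k)%:Z
     = \sum_(0 <= j < n.+1)
         (-1) ^+ (n - j) * ('C(n, j))%:Z * (Inv (k + j))%:Z :> int)%R
  /\ (Q (n + k) k = \sum_(0 <= j < k.+1) 'C(k, j) * M (n + j))%N
  /\ (Q (n + m + k) (m + k)
      = \sum_(0 <= j < m.+1) 'C(m, j) * Q (n + k + j) k)%N
  /\ (Q (n + k) k
      = \sum_(0 <= j < (minn n k).+1)
          'C(k, j) * 'C(n, j) * j`! * Inv (k - j) * M (n - j))%N
  /\ ((Q (n + k) k)%:R
      = \sum_(n.+1./2 <= j < (n + k).+1./2.+1)
          (k`!)%:R * inv_fact ((n + k)%:Z - (2 * j)%:Z)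
            * (Inv (n + k - 2 * j))%:R * (B n j)%:R :> rat)%R
  /\ (forall j : nat,
      (B n j)%:R
        = (n`!)%:R * (2 ^ (n%:Z - j%:Z))^-1
            * inv_fact (n%:Z - j%:Z) * inv_fact ((2 * j)%:Z - n%:Z) :> rat)%R.
Proof.
rewrite Q_involn -addnA Q_involn.
split; [|split; [|split; [|split; [|split]]]].
- rewrite involn_alternating_sum.
  by apply: eq_bigr => j _; rewrite Inv_involn.
- rewrite -[k in LHS]addn0 involn_sum_bin.
  by apply: eq_bigr => j _; rewrite M_involn.
- rewrite involn_sum_bin; apply: eq_bigr => j _.
  by rewrite addnAC Q_involn.
- rewrite involn_matching_sum (@big_cat_nat _ _ _ (minn n k).+1) //= ?ltnS ?geq_minl //.
  (* Terms with [j > k] vanish because ['C(k, j) = 0]. *)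
  rewrite [X in _ + X]big_nat [X in _ + X]big1 ?addn0; last first.
    by move=> j /andP[kj jn]; rewrite bin_small ?mul0n //; lia.
  by apply: eq_bigr => j _; rewrite Inv_involn M_involn.
- rewrite (@involn_bessel_sum _ _ (n + k).+1./2.+1); last by lia.
  rewrite (@big_cat_nat _ _ _ n.+1./2) //=; last by lia.
  (* Below the lower limit [2j < n], so the Bessel number is 0. *)
  rewrite [X in (X + _)%R]big_nat [X in (X + _)%R]big1 ?add0r; last first.
    by move=> j /andP[_ jn]; rewrite bessel_small ?mulr0 //; lia.
  by apply: eq_bigr => j _; rewrite Inv_involn B_bessel.
- by move=> j; rewrite B_bessel bessel_closed.
Qed.
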